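(* There exists a positive (absolute) constant $\delta$ such that the following holds. Let $n$ be a positive integer and suppose that $0 \le t \le \delta 3^{n-1}$. Then every $A \subseteq \mathbb{Z}_3^n$ with $3^{n-1} + t$ elements satisfies $$\mathrm{ST}(A) \ge 3^{n-1} t + t^2.$$ Moreover, equality holds when $A$ is the union of $\{x \in \mathbb{Z}_3^n : x_1 = 1\}$ and an arbitrary $t$-element sum-free subset of $\{x \in \mathbb{Z}_3^n : x_1 = 2\}$.
   Context: For a subset $A$ of a finite abelian group, $\mathrm{ST}(A) = |\{(x,y,z) \in A^3 : x+y=z\}|$ is the number of (ordered) Schur triples contained in $A$ (elements not necessarily distinct). A set is sum-free if it contains no $x,y,z$ (not necessarily distinct) with $x+y=z$. For $x \in \mathbb{Z}_3^n$, $x_1$ denotes its first coordinate. *)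

(* Defs.v *)
From mathcomp Require Import all_boot all_order all_algebra.

Set Implicit Arguments.
Unset Strict Implicit.
Unset Printing Implicit Defensive.

Import GRing.Theory.
Local Open Scope ring_scope.

Definition ST (G : finZmodType) (A : {set G}) : nat :=
  #|[set p : G * G * G | [&& p.1.1 \in A, p.1.2 \in A, p.2 \in A
                            & p.1.1 + p.1.2 == p.2]]|.

Definition sum_free (G : finZmodType) (A : {set G}) : Prop :=
  forall x y z : G, x \in A -> y \in A -> z \in A -> x + y <> z.

Definition slice (n : nat) (i : 'I_n) (c : 'Z_3) : {set 'rV['Z_3]_n} :=
  [set x : 'rV['Z_3]_n | x 0 i == c].

(* Main.v *)
Require Import Defs.
From mathcomp Require Import all_boot all_order all_algebra.
From mathcomp Require Import reals.
From mathcomp Require Import zify.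

Set Implicit Arguments.
Unset Strict Implicit.
Unset Printing Implicit Defensive.

Import Order.TTheory GRing.Theory Num.Theory.
Local Open Scope ring_scope.

(** Put [M = 3 ^ (n-1)]. The bound has two halves: a set with few Schur
    triples contains most of a coset of a subgroup of index 3, and for such a
    set the triples can be counted directly.

    Structure. If [A] were sum-free with exactly [M] elements, then for every
    [x] in [A] the sets [A], [A + x], [A - x] would be disjoint and hence
    partition the group, since each is a third of it. In other words, every
    line [u, u + x, u - x] would meet [A] exactly once. Take [u = - y] with
    [y] in [A]: neither [- y] nor [x - y] is in [A], so [- x - y] is. Thus [A]
    contains the third point of the line through any two of its points, and is
    an affine subspace.

    The argument is robust. [sum_bad_lines] bounds by [6 * ST A] the pairs
    [(x, u)] for which the line has the wrong number of points. Only that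
    [- y] is not in [A] needs a new reason, as the Schur triples
    [y + y = - y] are too few to matter. Comparing the pairs [(x, y)] and
    [(y, x)] just shows that [- y] is in [A] for almost all [y] or for almost no [y]
    ([sym_part_dichotomy]). If [A] were almost symmetric, changing the sign of
    one summand of [x + y + z] would almost always change its membership in
    [A]; three such changes give [- (x + y + z)], against the symmetry
    ([sym_part_small]). Therefore [- x - y] is in [A] for almost all pairs
    ([sum_nonclosed]), so that the translation by [x - y], which is the
    product of the reflections [u -> - y - u] and [u -> - x - u], almost
    preserves [A]. The elements that almost preserve [A] cannot be much more
    numerous than [A], and this forces them to form a genuine subgroup
    ([near_period_closed]), of index 3, one coset of which contains most of
    [A] ([near_slice]).

    Counting. Let [A] miss [b] points of that coset and have [a0], [a2]
    points in the subgroup and in the remaining coset. Each of the [a0] points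
    lies in at least [2 * (M - 2 * b)] triples whose other members are in the
    main coset, each of the [a2] points is a sum of two such members in at
    least [M - 2 * b] ways, and all but at most [a2 * b] of the [a2 ^ 2] sums of two
    points of [A] in the remaining coset fall in [A]. As [a0 + a2 = t + b],
    these total [M * t + t ^ 2] plus a nonnegative excess ([ST_near_slice]).
    For [b = a0 = 0] nothing is lost, which is the case of equality
    ([ST_slice_union]). *)

(** * Counting sums *)

Section SumCounts.
Local Open Scope nat_scope.
Variable G : finZmodType.
Implicit Types (A X Y Z : {set G}) (F : G -> nat) (d u v x y : G).

Definition sum_count X Y Z := \sum_(x in X) \sum_(y in Y) (x + y \in Z)%R.

Lemma sum_shift F d : \sum_u F (u + d)%R = \sum_u F u.
Proof. by rewrite [RHS](reindex_inj (addIr d)). Qed.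

Lemma sum_opp F : \sum_u F (- u)%R = \sum_u F u.
Proof. by rewrite [RHS](reindex_inj oppr_inj). Qed.

Lemma leq_sum_in A F : \sum_(u in A) F u <= \sum_u F u.
Proof. by rewrite big_mkcond; apply: leq_sum => u _; case: ifP. Qed.

Lemma sum_mem A : \sum_u (u \in A) = #|A|.
Proof.
by rewrite -sum1_card [RHS]big_mkcond; apply: eq_bigr => u _; case: ifP.
Qed.

Lemma leq_sum_subset X Y F :
  X \subset Y -> \sum_(u in X) F u <= \sum_(u in Y) F u.
Proof.
move=> /subsetP sXY; rewrite big_mkcond [leqRHS]big_mkcond.
by apply: leq_sum => u _; case: ifP => // /sXY ->.
Qed.

Lemma ST_sum_count A : ST A = sum_count A A A.
Proof.
pose f (q : G * G) := (q, q.1 + q.2)%R.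
have injf : injective f by move=> q q' [].
rewrite /ST /sum_count.
transitivity #|f @: [set q | [&& q.1 \in A, q.2 \in A & (q.1 + q.2)%R \in A]]|.
  apply: eq_card => p; rewrite !inE; apply/idP/imsetP.
    case/and4P=> h1 h2 h3 /eqP h4; exists p.1; first by rewrite inE h1 h2 h4.
    by rewrite /f h4; case: (p).
  by case=> q; rewrite inE => /and3P[h1 h2 h3] -> /=; rewrite h1 h2 h3 eqxx.
rewrite card_imset // -sum1_card pair_big_dep /=.
rewrite big_mkcond /= [RHS]big_mkcond /=; apply: eq_bigr => q _; rewrite inE.
by case: (q.1 \in A) => //=; case: (q.2 \in A) => //=; case: (_ \in A).
Qed.

Lemma sum_countE X Y Z :
  sum_count X Y Z = \sum_x \sum_y (x \in X) * (y \in Y) * (x + y \in Z)%R.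
Proof.
rewrite /sum_count big_mkcond; apply: eq_bigr => x _.
case: (x \in X); last by rewrite big1.
rewrite big_mkcond; apply: eq_bigr => y _.
by case: (y \in Y); rewrite ?mul1n.
Qed.

(** Choosing the sum and one summand determines the other summand. *)
Lemma sum_count_target X Y Z :
  sum_count X Y Z = \sum_(z in Z) \sum_(y in Y) (z - y \in X)%R.
Proof.
rewrite /sum_count exchange_big [RHS]exchange_big /=; apply: eq_bigr => y _.
rewrite big_mkcond [RHS]big_mkcond /= -[RHS](sum_shift _ y).
apply: eq_bigr => x _; rewrite addrK.
by case: (x \in X); case: (x + y \in Z)%R.
Qed.

Lemma sum_countC X Y Z : sum_count X Y Z = sum_count Y X Z.
Proof.
rewrite /sum_count exchange_big; apply: eq_bigr => y _.
by apply: eq_bigr => x _; rewrite addrC.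
Qed.

(** * Overlaps and lines *)

Definition overlap A d := \sum_(u in A) (u + d \in A)%R.

Lemma ST_overlap A : ST A = \sum_(x in A) overlap A x.
Proof.
rewrite ST_sum_count; apply: eq_bigr => x _.
by apply: eq_bigr => y _; rewrite addrC.
Qed.

Lemma overlapE A d : overlap A d = \sum_u (u \in A) * (u + d \in A)%R.
Proof.
rewrite /overlap big_mkcond; apply: eq_bigr => u _.
by case: ifP; rewrite ?mul1n.
Qed.

Lemma overlapN A d : overlap A (- d)%R = overlap A d.
Proof.
rewrite !overlapE -[LHS](sum_shift _ d); apply: eq_bigr => u _.
by rewrite addrK mulnC.
Qed.

Lemma sum_overlap A : \sum_d overlap A d = #|A| ^ 2.
Proof.
rewrite exchange_big /= -mulnn -sum_nat_const; apply: eq_bigr => u _.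
under eq_bigr => d _ do rewrite addrC.
by rewrite (sum_shift (fun v => nat_of_bool (v \in A))) sum_mem.
Qed.

(** In a group of exponent 3 the points [u], [u + x], [u - x] form the line
    through [u] with direction [x]. *)
Definition line_count A x u :=
  (u \in A) + (u + x \in A)%R + (u - x \in A)%R.

(** The average number of points of [A] on a line with direction [x] is
    [3 * #|A| / #|G| >= 1], and the pairs of points of [A] on such lines are
    counted by [overlap A x]. If few lines have two points, the average leaves
    few lines without any. *)
Lemma bad_lines A x :
    (forall v, v *+ 3 = 0)%R -> #|G| <= 3 * #|A| ->
  \sum_u (line_count A x u != 1) <= 6 * overlap A x.
Proof.
move=> exp3 cardA.
have two v : (- v - v = v)%R.
  by apply/eqP; rewrite -opprD eqr_oppLR -subr_eq0 opprK -mulr2n -mulrSr exp3.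
(* A line with k points in A satisfies (k != 1) + k <= 1 + k * (k - 1). *)
have: \sum_u ((line_count A x u != 1) + line_count A x u) <=
  \sum_u (1 + 2 * ((u \in A) * (u + x \in A)%R + (u \in A) * (u - x \in A)%R
    + (u + x \in A)%R * (u - x \in A)%R)).
  apply: leq_sum => u _; rewrite /line_count.
  by case: (u \in A); case: (u + x \in A)%R; case: (u - x \in A)%R.
have third : \sum_u (u + x \in A)%R * (u - x \in A)%R = overlap A x.
  rewrite -(sum_shift _ (- x)) overlapE; apply: eq_bigr => u _.
  by rewrite subrK -addrA two.
rewrite !big_split /= big1_eq third -!overlapE overlapN.
rewrite !(sum_shift (fun v => nat_of_bool (v \in A))) !sum_mem sum1_card.
have -> : #|xpredT : pred G| = #|G| by []; lia.
Qed.

Lemma sum_bad_lines A :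
    (forall v, v *+ 3 = 0)%R -> #|G| <= 3 * #|A| ->
  \sum_(x in A) \sum_u (line_count A x u != 1) <= 6 * ST A.
Proof.
move=> exp3 cardA; rewrite ST_overlap big_distrr /=.
by apply: leq_sum => x _; apply: bad_lines.
Qed.

(** * Opposite elements *)

(** Outside these exceptional pairs, exactly one of [- y] and [- x - y] is in
    [A]: they are two points of the line through [- y] with direction [x], and
    its third point [x - y] is rarely in [A] because [(x - y) + y = x]. *)
Lemma bad_negations A :
    (forall v, v *+ 3 = 0)%R -> #|G| <= 3 * #|A| ->
  \sum_(x in A) \sum_(y in A) ((- y \in A)%R + (- x - y \in A)%R != 1)
    <= 7 * ST A.
Proof.
move=> exp3 cardA.
have diffs : \sum_(x in A) \sum_(y in A) (x - y \in A)%R = ST A.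
  rewrite exchange_big ST_overlap; apply: eq_bigr => y _.
  by rewrite -overlapN.
rewrite (_ : 7 * ST A = 6 * ST A + ST A); last lia.
apply: leq_trans (leq_add (sum_bad_lines exp3 cardA) (leqnn _)).
rewrite -[X in _ <= _ + X]diffs -big_split /=; apply: leq_sum => x _.
rewrite -sum_opp; apply: leq_trans (leq_add (leq_sum_in A _) (leqnn _)).
rewrite -big_split /=; apply: leq_sum => y _; rewrite /line_count.
rewrite [(- y + x)%R]addrC [(- y - x)%R]addrC.
by case: (- y \in A)%R; case: (x - y \in A)%R; case: (- x - y \in A)%R.
Qed.

Definition sym_part A := [set x in A | - x \in A]%R.

Lemma sum_negations A : \sum_(x in A) (- x \in A)%R = #|sym_part A|.
Proof.
rewrite -sum1_card big_mkcond [RHS]big_mkcond /=; apply: eq_bigr => x _.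
by rewrite inE; case: (x \in A); case: (- x \in A)%R.
Qed.

(** An element [x] of [A] with [- x] outside [A] is counted for [u = x] and for
    [u = - x]. *)
Lemma sum_asymmetries A :
  \sum_u ((u \in A) != (- u \in A)%R) = 2 * (#|A| - #|sym_part A|).
Proof.
have e : \sum_u ((u \in A) != (- u \in A)%R) + 2 * #|sym_part A| = 2 * #|A|.
  transitivity (\sum_u (u \in A) + \sum_u (- u \in A)%R).
    rewrite mul2n -addnn -!sum_negations [\sum_(x in A) _]big_mkcond.
    rewrite -!big_split; apply: eq_bigr => u _ /=.
    by case: (u \in A); case: (- u \in A)%R.
  by rewrite (sum_opp (fun u => nat_of_bool (u \in A))) sum_mem mul2n addnn.
lia.
Qed.

(** As [- x - y] is symmetric in [x] and [y], for most pairs it is outside [A]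
    if and only if [- x] is in [A], and also if and only if [- y] is in [A].
    Twice the product below is the number of pairs for which only one of [- x]
    and [- y] is in [A]. *)
Lemma sym_part_dichotomy A :
    (forall v, v *+ 3 = 0)%R -> #|G| <= 3 * #|A| ->
  #|sym_part A| * (#|A| - #|sym_part A|) <= 7 * ST A.
Proof.
move=> exp3 cardA; have bad := bad_negations exp3 cardA.
set p := #|sym_part A|.
have mismatch : \sum_(x in A) \sum_(y in A) ((- x \in A) != (- y \in A))%R
    <= 14 * ST A.
  rewrite (_ : 14 * ST A = 7 * ST A + 7 * ST A); last lia.
  apply: leq_trans (leq_add bad bad).
  rewrite [X in _ <= _ + X]exchange_big /= -big_split /=.
  apply: leq_sum => x _; rewrite -big_split /=; apply: leq_sum => y _.
  rewrite [(- y - x)%R]addrC.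
  by case: (- y \in A)%R; case: (- x \in A)%R; case: (- x - y \in A)%R.
have both : \sum_(x in A) \sum_(y in A) (- x \in A)%R * (- y \in A)%R = p * p.
  rewrite {1}/p -sum_negations big_distrl; apply: eq_bigr => x _.
  by rewrite /p -sum_negations big_distrr.
have cut : \sum_(x in A) \sum_(y in A) ((- x \in A) != (- y \in A))%R
     + (p * p + p * p) = 2 * p * #|A|.
  transitivity (\sum_(x in A) \sum_(y in A) ((- x \in A)%R + (- y \in A)%R)).
    rewrite -both -!big_split /=; apply: eq_bigr => x _.
    rewrite -!big_split /=; apply: eq_bigr => y _.
    by case: (- y \in A)%R; case: (- x \in A)%R.
  under eq_bigr => x _ do rewrite big_split /= sum_nat_const sum_negations.
  by rewrite big_split /= sum_nat_const -big_distrr /= sum_negations -/p; lia.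
have lepA : p <= #|A| by apply: subset_leq_card; apply/subsetP=> x /setIdP[].
nia.
Qed.

Lemma sum_opp_sym_part A F :
  \sum_(x in sym_part A) F (- x)%R = \sum_(x in sym_part A) F x.
Proof.
rewrite [RHS](reindex_inj oppr_inj); apply: eq_bigl => x.
by rewrite !inE opprK andbC.
Qed.

Definition bad_flip A x y z : bool :=
  (x + y + z \in A)%R + (- x + y + z \in A)%R != 1.

(** The points [x + y + z] and [- x + y + z] lie with [y + z], which is rarely
    in [A], on a line with direction [x]. *)
Lemma sum_bad_flips A :
    (forall v, v *+ 3 = 0)%R -> #|G| <= 3 * #|A| ->
  \sum_(z in A) \sum_(x in A) \sum_(y in A) bad_flip A x y z
    <= 7 * ST A * #|A|.
Proof.
move=> exp3 cardA.
have lines : \sum_(z in A) \sum_(x in A) \sum_(y in A)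
    (line_count A x (y + z)%R != 1) <= #|A| * (6 * ST A).
  rewrite -sum_nat_const; apply: leq_sum => z _.
  apply: leq_trans (sum_bad_lines exp3 cardA); apply: leq_sum => x _.
  by rewrite -[leqRHS](sum_shift _ z); apply: leq_sum_in.
have sums : \sum_(z in A) \sum_(x in A) \sum_(y in A) (y + z \in A)%R
    = #|A| * ST A.
  rewrite exchange_big /= -sum_nat_const; apply: eq_bigr => x _.
  by rewrite ST_overlap.
rewrite (_ : 7 * ST A * #|A| = #|A| * (6 * ST A) + #|A| * ST A); last lia.
apply: leq_trans (leq_add lines (leqnn _)).
rewrite -[X in _ <= _ + X]sums -big_split /=; apply: leq_sum => z _.
rewrite -big_split /=; apply: leq_sum => x _.
rewrite -big_split /=; apply: leq_sum => y _.
rewrite /line_count /bad_flip -[(- x + y + z)%R]addrA [(- x + _)%R]addrC.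
rewrite -[(x + y + z)%R]addrA [(x + _)%R]addrC.
by case: (y + z + x \in A)%R; case: (y + z - x \in A)%R; case: (y + z \in A)%R.
Qed.

(** On triples of the symmetric set [P = A :&: - A] all signs can be changed one
    after the other. Unless one of the three changes is exceptional, exactly one
    of [s] and [- s] is in [A] for [s = x + y + z]; but few elements [s] have
    this property if [P] is more than half of [A], since then it is most of [A]
    by [sym_part_dichotomy]. *)
Lemma sym_part_small A :
    (forall v, v *+ 3 = 0)%R -> #|G| <= 3 * #|A| -> 280 * ST A < #|A| ^ 2 ->
  2 * #|sym_part A| < #|A|.
Proof.
move=> exp3 cardA fewST; rewrite ltnNge; apply/negP => bigP.
have dicho := sym_part_dichotomy exp3 cardA.
set P := sym_part A in bigP dicho *.
have sPA : P \subset A by apply/subsetP=> x /setIdP[].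
have lePA := subset_leq_card sPA.
pose E := \sum_(z in P) \sum_(x in P) \sum_(y in P) bad_flip A x y z.
have leE : E <= 7 * ST A * #|A|.
  apply: leq_trans (sum_bad_flips exp3 cardA).
  apply: leq_trans (leq_sum_subset _ sPA); apply: leq_sum => z _.
  apply: leq_trans (leq_sum_subset _ sPA); apply: leq_sum => x _.
  exact: leq_sum_subset.
pose asym u : bool := (u \in A) != (- u \in A)%R.
have flips : #|P| ^ 3 <= E + E + E
    + \sum_(z in P) \sum_(x in P) \sum_(y in P) asym (x + y + z)%R.
  (* E2 and E3 count the exceptions to the second and third change of sign. *)
  have E2 : \sum_(z in P) \sum_(x in P) \sum_(y in P) bad_flip A y (- x) z = E.
    apply: eq_bigr => z _; rewrite [RHS]exchange_big /=.
    exact: (sum_opp_sym_part A (fun x => \sum_(y in P) bad_flip A y x z)).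
  have E3 : \sum_(z in P) \sum_(x in P) \sum_(y in P) bad_flip A z (- x) (- y)
      = E.
    rewrite [RHS]exchange_big /=; apply: eq_bigr => z _.
    rewrite [RHS]exchange_big /=.
    rewrite -[RHS]sum_opp_sym_part; apply: eq_bigr => x _.
    exact: (sum_opp_sym_part A (fun y => nat_of_bool (bad_flip A z (- x) y))).
  rewrite -{2}E2 -{2}E3 -!big_split expnS -mulnn -sum_nat_const /=.
  apply: leq_sum => z _.
  rewrite -!big_split -sum_nat_const /=; apply: leq_sum => x _.
  rewrite -!big_split -sum1_card /=; apply: leq_sum => y _.
  rewrite /bad_flip /asym !opprD.
  rewrite [(y - x)%R]addrC [(- y - x)%R]addrC.
  rewrite -[(z - x - y)%R]addrA [(z + _)%R]addrC.
  rewrite -[(- z - x - y)%R]addrA [(- z + _)%R]addrC.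
  case: (x + y + z \in A)%R; case: (- x + y + z \in A)%R;
  by case: (- x - y + z \in A)%R; case: (- x - y - z \in A)%R.
have leasym : \sum_(z in P) \sum_(x in P) \sum_(y in P) asym (x + y + z)%R
    <= #|P| * (#|P| * (2 * (#|A| - #|P|))).
  rewrite -!sum_nat_const; apply: leq_sum => z _; apply: leq_sum => x _.
  rewrite -sum_asymmetries -(sum_shift _ (x + z)%R).
  apply: leq_trans (leq_sum_in P _).
  by apply: leq_sum => y _; rewrite addrCA addrA.
set a := #|A| in fewST bigP dicho lePA leE leasym *.
set p := #|P| in bigP dicho lePA flips leasym *.
set s := ST A in fewST dicho leE *.
have p_cube : p ^ 3 <= p * (70 * s).
  apply: leq_trans flips _.
  have: 2 * (p * (p * (a - p))) <= 2 * (p * (7 * s)).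
    by rewrite !leq_mul2l dicho !orbT.
  have: s * a <= s * (2 * p) by rewrite leq_mul2l bigP orbT.
  lia.
have p_gt0 : 0 < p.
  by rewrite lt0n; apply: contraTneq bigP => ->; rewrite -ltnNge; nia.
have: p ^ 2 <= 70 * s by rewrite -(leq_pmul2l p_gt0) -expnS.
nia.
Qed.

(** Now [- y] is in [A] for few [y], so for most pairs the one of [- y] and
    [- x - y] that is in [A] is [- x - y]. *)
Lemma sum_nonclosed A :
    (forall v, v *+ 3 = 0)%R -> #|G| <= 3 * #|A| -> 280 * ST A < #|A| ^ 2 ->
  \sum_(x in A) \sum_(y in A) (- x - y \notin A)%R <= 21 * ST A.
Proof.
move=> exp3 cardA fewST; have smallP := sym_part_small exp3 cardA fewST.
have dicho := sym_part_dichotomy exp3 cardA.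
apply: (@leq_trans (7 * ST A + #|A| * #|sym_part A|)); last by nia.
apply: leq_trans (leq_add (bad_negations exp3 cardA) (leqnn _)).
rewrite -sum_nat_const -big_split /=; apply: leq_sum => x _.
rewrite -sum_negations -big_split /=; apply: leq_sum => y _.
by case: (- y \in A)%R; case: (- x - y \in A)%R.
Qed.

(** * Near-periods *)

Definition defect A d := \sum_(u in A) (u + d \notin A)%R.

Lemma defect_overlap A d : defect A d + overlap A d = #|A|.
Proof.
rewrite -sum1_card -big_split /=; apply: eq_bigr => u _.
by case: (u + d \in A)%R.
Qed.

Lemma defectN A d : defect A (- d)%R = defect A d.
Proof.
by apply/eqP; rewrite -(eqn_add2r (overlap A d)) -{1}overlapN !defect_overlap.
Qed.

Lemma defect0 A : defect A 0%R = 0.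
Proof. by apply: big1 => u Au; rewrite addr0 Au. Qed.

Lemma defectD A d e : defect A (d + e)%R <= defect A d + defect A e.
Proof.
have: \sum_(u in A) (u + d \in A)%R * (u + d + e \notin A)%R <= defect A e.
  apply: leq_trans (leq_sum_in A _) _.
  rewrite (sum_shift (fun v => (v \in A) * (v + e \notin A)%R)).
  rewrite /defect [leqRHS]big_mkcond; apply: leq_sum => u _.
  by case: (u \in A); rewrite ?mul1n.
rewrite -(leq_add2l (defect A d)); apply: leq_trans.
rewrite -big_split /=; apply: leq_sum => u _; rewrite addrA.
by case: (u + d \in A)%R; case: (u + d + e \in A)%R.
Qed.

(** Reflecting [u] first by [u -> - x - u] and then by [u -> - y - u] translates
    it by [x - y]; the two sums count the points that leave [A] on the way. *)
Lemma defect_sub A x y :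
  defect A (x - y)%R <= \sum_(u in A) (- x - u \notin A)%R
                    + \sum_(u in A) (- y - u \notin A)%R.
Proof.
have: \sum_(u in A) (- x - u \in A)%R * (u + (x - y) \notin A)%R
   <= \sum_(u in A) (- y - u \notin A)%R.
  apply: leq_trans (leq_sum_in A _) _; rewrite -sum_opp -(sum_shift _ x).
  rewrite [leqRHS]big_mkcond; apply: leq_sum => u _.
  rewrite opprK [(- x + _)%R]addrC addrK opprD addrA subrK [(- u - y)%R]addrC.
  by case: (u \in A); rewrite ?mul1n.
rewrite -(leq_add2l (\sum_(u in A) (- x - u \notin A)%R)); apply: leq_trans.
rewrite -big_split /=; apply: leq_sum => u _.
by case: (- x - u \in A)%R; case: (u + (x - y) \in A)%R.
Qed.

(** Translation by a near-period of level [k] moves at most [k / 16] of the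
    points of [A] out of [A]. The unit [1 / 16] is small enough for the size
    estimates below to leave a factor less than 2 between levels 1 and 5. *)
Definition near_period A k := [set d | 16 * defect A d <= k * #|A|].

Lemma near_periodN A k d :
  (- d \in near_period A k)%R = (d \in near_period A k).
Proof. by rewrite !inE defectN. Qed.

Lemma near_periodD A k l d e :
    d \in near_period A k -> e \in near_period A l ->
  (d + e \in near_period A (k + l))%R.
Proof. by rewrite !inE => hd he; have := defectD A d e; lia. Qed.

Lemma sub_near_period A k l :
  k <= l -> near_period A k \subset near_period A l.
Proof.
move=> lekl; apply/subsetP => d; rewrite !inE => /leq_trans-> //.
by rewrite leq_mul2r lekl orbT.
Qed.

(** A near-period contributes at least [(1 - k / 16) * #|A|] to
    [\sum_d overlap A d], whose value is [#|A| ^ 2]. *)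
Lemma card_near_period A k :
  #|near_period A k| * ((16 - k) * #|A|) <= 16 * #|A| ^ 2.
Proof.
rewrite -sum_overlap big_distrr /= -sum_nat_const.
apply: leq_trans (leq_sum_in (near_period A k) _); apply: leq_sum => d.
by rewrite inE -(defect_overlap A d) mulnBl; lia.
Qed.

(** If [g] is a near-period of level 4, then [D] and [D + g], where [D] is the
    set of near-periods of level 1, are both contained in level 5, which has
    fewer than [2 * #|D|] elements. They meet, so [g] is a difference of
    elements of [D]. As level 4 contains the sums of elements of level 2, it
    follows that level 2 is a subgroup. *)
Lemma near_period_closed A :
    4 * #|A| <= 5 * #|near_period A 1| ->
  near_period A 4 \subset near_period A 2.
Proof.
have [A0 | A_gt0] := posnP #|A|.
  by move=> _; apply/subsetP=> d; rewrite !inE A0 !muln0.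
move=> big; have := card_near_period A 5.
rewrite -mulnn !mulnA leq_pmul2r //= => small.
apply/subsetP => g Dg.
pose T : {set G} := [set (d + g)%R | d in near_period A 1].
have cT : #|T| = #|near_period A 1| by rewrite card_imset //; exact: addIr.
have sT : T :|: near_period A 1 \subset near_period A 5.
  rewrite subUset sub_near_period // andbT; apply/subsetP => _ /imsetP[d Dd ->].
  exact: (@near_periodD A 1 4).
have := subset_leq_card sT; rewrite cardsU cT => le5.
have : T :&: near_period A 1 != set0.
  apply/eqP=> T0; move: le5 A_gt0 big small; rewrite T0 cards0 subn0.
  by set a := #|A|; set n1 := #|_|; set n5 := #|_|; lia.
case/set0Pn => v; rewrite inE => /andP[/imsetP[d Dd ->]] De.
have -> : g = (d + g - d)%R by rewrite addrAC subrr add0r.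
by apply: (@near_periodD A 1 1) => //; rewrite near_periodN.
Qed.

(** * From near-periods to a coset *)

(** Three cosets [H], [c + H], [- c + H] are disjoint and there is no room for a
    fourth one, so they exhaust the group. The index [k] of the coset
    [c *+ k + H] that contains [x] is the required character. *)
Lemma subgroup_character (H : {set G}) (c : G) :
    (forall v, v *+ 3 = 0)%R ->
    0%R \in H -> {in H &, forall x y, x - y \in H}%R ->
    c \notin H -> #|G| < 4 * #|H| ->
  exists cl : G -> 'Z_3, {morph cl : x y / (x + y)%R} /\
    forall x, (cl x == 1%R) = (x - c \in H)%R.
Proof.
move=> exp3 H0 Hsub cH bigH.
have HN : {in H, forall x, - x \in H}%R.
  by move=> x Hx; rewrite -sub0r; apply: Hsub.
have HD : {in H &, forall x y, x + y \in H}%R.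
  by move=> x y Hx Hy; rewrite -[y]opprK; apply: Hsub => //; apply: HN.
pose m (k : 'Z_3) := (c *+ k)%R.
have mD k l : m (k + l)%R = (m k + m l)%R.
  rewrite /m /= -mulrnDr [in RHS](divn_eq (k + l) 3) mulrnDr mulnC mulrnA exp3.
  by rewrite mul0rn add0r.
have mB k l : m (k - l)%R = (m k - m l)%R.
  by apply/eqP; rewrite eq_sym subr_eq -mD subrK.
have mH k : m k \in H -> k = 0%R.
  case: k => [[|[|[|//]]] lt3] // mkH; first exact: val_inj.
    by case/negP: cH.
  case/negP: cH; rewrite -[c]opprK; apply: HN.
  suff -> : (- c = m (Ordinal lt3))%R by [].
  by apply/eqP; rewrite eq_sym -addr_eq0 /m /= -mulrSr exp3.
have mHB k l : (m k - m l \in H)%R -> k = l.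
  by rewrite -mB => /mH/eqP; rewrite subr_eq0 => /eqP.
have exk z : exists k, (z - m k \in H)%R.
  apply/existsP; apply: contraLR bigH.
  rewrite negb_exists -leqNgt => /forallP noz.
  (* A point z outside the three cosets gives a fourth translate of H, indexed
     by None, and hence four disjoint translates. *)
  pose f (q : G * option 'Z_3) := (q.1 + (if q.2 is Some k then m k else z))%R.
  have injf : {in setX H [set: option 'Z_3] &, injective f}.
    have eqD (h h' v v' : G) : (h + v = h' + v' -> v - v' = h' - h)%R.
      by move=> /(canRL (addKr _)) ->; rewrite addrA addrK addrC.
    have none h h' k : h \in H -> h' \in H -> (h + z = h' + m k)%R -> False.
      by move=> Hh Hh' /eqD e; case/negP: (noz k); rewrite e; apply: Hsub.
    move=> [h k] [h' k']; rewrite !inE !andbT /f /= => Hh Hh'.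
    case: k k' => [k|] [k'|] e.
    - have ek : k = k' by apply: mHB; rewrite (eqD _ _ _ _ e); apply: Hsub.
      by move: e; rewrite ek => /addIr ->.
    - by case: (none _ _ _ Hh' Hh (esym e)).
    - by case: (none _ _ _ Hh Hh' e).
    - by move: e => /addIr ->.
  have := max_card (mem (f @: setX H [set: option 'Z_3])).
  by rewrite card_in_imset // cardsX cardsT card_option card_ord mulnC.
pose cl z := odflt 0%R [pick k | (z - m k \in H)%R].
have clH z : (z - m (cl z) \in H)%R.
  rewrite /cl; case: pickP => [k //|no].
  by case: (exk z) => k; have /= -> := no k.
have clE z k : (z - m k \in H)%R -> cl z = k.
  move=> zk; apply: mHB; have := Hsub _ _ zk (clH z).
  by rewrite opprB addrC addrA subrK.
exists cl; split=> [x y | x].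
  by apply: clE; rewrite mD opprD addrACA HD.
apply/eqP/idP => [e | xc]; first by have := clH x; rewrite e /m mulr1n.
by apply: clE.
Qed.

(** The set [X] consists of the points [x] of [A] for which the reflection [u
    -> - x - u] almost preserves [A]; by Markov's inequality it is most of
    [A], and differences of its elements are near-periods of level 1. With [c]
    in [X] and [H] the subgroup of near-periods of level 2, the coset [c + H]
    contains [X]. The constant [3360 = 5 * 32 * 21] comes from Markov's
    inequality. *)
Lemma near_slice A :
    (forall v, v *+ 3 = 0)%R -> #|G| <= 3 * #|A| -> 3360 * ST A <= #|A| ^ 2 ->
  exists cl : G -> 'Z_3, [/\ {morph cl : x y / (x + y)%R},
    exists c, cl c = 1%R & 4 * #|A| <= 5 * #|[set x in A | cl x == 1%R]|].
Proof.
move=> exp3 cardA fewST.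
have A_gt0 : 0 < #|A|.
  have G_gt0 : 0 < #|G| by apply/card_gt0P; exists 0%R.
  by rewrite lt0n; apply: contraTneq cardA => ->; rewrite muln0 -ltnNge.
pose e x := \sum_(y in A) (- x - y \notin A)%R.
have sum_e : \sum_(x in A) e x <= 21 * ST A.
  by apply: sum_nonclosed => //; nia.
pose X := [set x in A | 32 * e x <= #|A|].
have sXA : X \subset A by apply/subsetP=> x /setIdP[].
have bigX : 4 * #|A| <= 5 * #|X|.
  have markov : #|A :\: X| * #|A| <= 32 * \sum_(x in A) e x.
    rewrite big_distrr /= -sum_nat_const.
    apply: leq_trans (leq_sum_subset _ (subsetDl A X)); apply: leq_sum => x.
    by rewrite !inE => /andP[+ Ax]; rewrite Ax /= -ltnNge => /ltnW.
  have := cardsID X A; rewrite (setIidPr sXA) => cardX.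
  have : 5 * #|A :\: X| <= #|A| by rewrite -(leq_pmul2r A_gt0) mulnn; lia.
  by move: cardX; set i := #|X|; set j := #|A :\: X|; set a := #|A|; lia.
have /card_gt0P[c Xc] : 0 < #|X| by move: A_gt0 bigX; case: #|X|; lia.
have XD x : x \in X -> (x - c \in near_period A 1)%R.
  move: Xc; rewrite !inE => /andP[_ ec] /andP[_ ex].
  have := defect_sub A x c; rewrite -/(e x) -/(e c).
  by move: ec ex; set d := defect _ _; lia.
have bigD : 4 * #|A| <= 5 * #|near_period A 1|.
  apply: leq_trans bigX _; rewrite leq_mul2l /=.
  rewrite -(card_imset X (addIr (- c)%R)); apply: subset_leq_card.
  by apply/subsetP => _ /imsetP[x Xx ->]; apply: XD.
have D42 := subsetP (near_period_closed bigD).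
pose H := near_period A 2.
have sD1H : near_period A 1 \subset H by apply: sub_near_period.
have H0 : 0%R \in H by rewrite inE defect0.
have HB : {in H &, forall x y, x - y \in H}%R.
  move=> x y Hx Hy; apply/D42/(@near_periodD A 2 2) => //.
  by rewrite near_periodN.
have cH : c \notin H.
  (* Otherwise all of X lies in H, and an element of A that is a near-period
     is the summand of many Schur triples. *)
  apply/negP => Hc.
  have XH x : x \in X -> x \in H.
    move=> Xx; apply/D42/(subsetP (@sub_near_period A 3 4 isT)).
    by rewrite -[x](subrK c); apply: (@near_periodD A 1 2) => //; apply: XD.
  have : #|X| * (14 * #|A|) <= 16 * ST A.
    rewrite ST_overlap big_distrr /= -sum_nat_const.
    apply: leq_trans (leq_sum_subset _ sXA); apply: leq_sum => x /XH.
    by rewrite inE -(defect_overlap A x); lia.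
  by move: A_gt0 bigX fewST; set i := #|X|; set a := #|A|; nia.
have bigH : #|G| < 4 * #|H|.
  have := subset_leq_card sD1H; move: bigD cardA A_gt0.
  by set i := #|near_period _ _|; set j := #|H|; set a := #|A|; lia.
have [cl [clD clE]] := subgroup_character exp3 H0 HB cH bigH.
exists cl; split=> //; first by exists c; apply/eqP; rewrite clE subrr.
apply: leq_trans bigX _; rewrite leq_mul2l /=; apply: subset_leq_card.
apply/subsetP => x Xx; rewrite inE (subsetP sXA) // clE.
by apply: (subsetP sD1H); apply: XD.
Qed.

(** * Sets that contain most of a coset *)

Lemma sum_Z3 (F : 'Z_3 -> nat) : \sum_k F k = F 0%R + F 1%R + F 2%R.
Proof.
rewrite !big_ord_recl big_ord0 addn0 addnA.
by congr (_ + _ + _); congr F; apply: val_inj.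
Qed.

Definition fiber (cl : G -> 'Z_3) (k : 'Z_3) := [set x | cl x == k].

Lemma card_fiber (cl : G -> 'Z_3) (c : G) (k : 'Z_3) :
  {morph cl : x y / (x + y)%R} -> cl c = 1%R -> 3 * #|fiber cl k| = #|G|.
Proof.
move=> clD clc.
have step j : #|fiber cl j| <= #|fiber cl (j + 1)%R|.
  rewrite -(card_imset (fiber cl j) (addIr c)); apply: subset_leq_card.
  by apply/subsetP => _ /imsetP[x + ->]; rewrite !inE clD clc => /eqP->.
have eq_fib j : #|fiber cl j| = #|fiber cl (j + 1)%R|.
  apply/eqP; rewrite eqn_leq step; apply: leq_trans (step _) _.
  apply: leq_trans (step _) _; suff -> : (j + 1 + 1 + 1 = j)%R by [].
  by rewrite -!addrA -[RHS]addr0; congr (_ + _)%R; apply: val_inj.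
have all_eq j : #|fiber cl j| = #|fiber cl 0%R|.
  have e0 := eq_fib 0%R; have e1 := eq_fib (0 + 1)%R.
  case: j => [[|[|[|//]]] ?].
  - by congr #|fiber cl _|; apply: val_inj.
  - by rewrite e0; congr #|fiber cl _|; apply: val_inj.
  - by rewrite e0 e1; congr #|fiber cl _|; apply: val_inj.
rewrite -[RHS]sum1_card (partition_big cl predT) //= sum_Z3 all_eq.
have size_fiber j : \sum_(x in G | cl x == j) 1 = #|fiber cl 0%R|.
  by rewrite -(all_eq j) -sum1_card; apply: eq_bigl => x; rewrite /fiber !inE.
by rewrite !size_fiber; lia.
Qed.

(** The injection [f] sends at most [#|Y| - #|Z|] points of [X] outside [Z]. *)
Lemma inj_hits X Y Z (f : G -> G) :
    injective f -> {in X, forall x, f x \in Y} -> Z \subset Y ->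
  #|X| <= \sum_(x in X) (f x \in Z) + (#|Y| - #|Z|).
Proof.
move=> injf fXY sZY.
have split_X : \sum_(x in X) (f x \in Z) + \sum_(x in X) (f x \notin Z) = #|X|.
  rewrite -sum1_card -big_split /=; apply: eq_bigr => x _.
  by case: (f x \in Z).
rewrite -split_X leq_add2l -[in #|Z|](setIidPr sZY) -cardsD.
have -> : \sum_(x in X) (f x \notin Z) = #|[set x in X | f x \notin Z]|.
  rewrite -sum1_card big_mkcond [RHS]big_mkcond /=; apply: eq_bigr => x _.
  by rewrite inE; case: (x \in X) => //; case: (f x \in Z).
rewrite -(card_imset _ injf); apply: subset_leq_card.
apply/subsetP => _ /imsetP[x + ->]; rewrite !inE => /andP[Xx ->].
exact: fXY.
Qed.

(** Writing [k] for the points of [A] in [fiber cl k], the Schur triples of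
    types [0 + 1 = 1], [1 + 0 = 1], [1 + 1 = 2] and [2 + 2 = 1] are bounded
    separately, with [inj_hits] for the last two and the first; the second is
    its mirror image. *)
Lemma ST_near_slice A (cl : G -> 'Z_3) (c : G) (M t : nat) :
    {morph cl : x y / (x + y)%R} -> cl c = 1%R -> #|G| = 3 * M ->
    #|A| = M + t -> 10 * t <= M -> 4 * M <= 5 * #|[set x in A | cl x == 1%R]| ->
  M * t + t ^ 2 <= ST A.
Proof.
move=> clD clc cardG cardA smallt bigA.
pose P k := [set x in A | cl x == k].
have cardF k : #|fiber cl k| = M by have := card_fiber k clD clc; lia.
have sPF k : P k \subset fiber cl k.
  by apply/subsetP => x; rewrite !inE => /andP[].
have leP : #|P 1%R| <= M by rewrite -(cardF 1%R) subset_leq_card.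
have parts : #|P 0%R| + #|P 1%R| + #|P 2%R| = M + t.
  rewrite -cardA -[RHS]sum1_card (partition_big cl predT) //= sum_Z3.
  by congr (_ + _ + _); rewrite -sum1_card; apply: eq_bigl => x; rewrite inE.
have split_ST :
    sum_count (P 0%R) (P 1%R) (P 1%R) + sum_count (P 1%R) (P 0%R) (P 1%R)
    + sum_count (P 1%R) (P 1%R) (P 2%R) + sum_count (P 2%R) (P 2%R) (P 1%R)
    <= ST A.
  rewrite ST_sum_count !sum_countE -!big_split; apply: leq_sum => x _ /=.
  rewrite -!big_split; apply: leq_sum => y _ /=; rewrite !inE clD.
  case: (x \in A); case: (y \in A); case: (x + y \in A)%R => //=;
    rewrite ?muln0 //.
  by case: (cl x) => [[|[|[|//]]] ?]; case: (cl y) => [[|[|[|//]]] ?].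
set a0 := #|P 0%R| in parts; set a1 := #|P 1%R| in parts leP bigA.
set a2 := #|P 2%R| in parts.
have zero_one :
    a0 * M <= sum_count (P 0%R) (P 1%R) (P 1%R) + a0 * (2 * (M - a1)).
  rewrite -!sum_nat_const -big_split /=; apply: leq_sum => x.
  rewrite inE => /andP[_ /eqP clx].
  have := @inj_hits (P 1%R) (fiber cl 1%R) (P 1%R) _ (addrI x) _ (sPF 1%R).
  rewrite cardF -/a1 => hits.
  suff : a1 <= \sum_(y in P 1%R) (x + y \in P 1%R)%R + (M - a1).
    by move: leP; set s := \sum_(_ in _) _; lia.
  by apply: hits => y; rewrite !inE clD clx add0r => /andP[].
have one_one :
    a2 * M <= sum_count (P 1%R) (P 1%R) (P 2%R) + a2 * (2 * (M - a1)).
  rewrite sum_count_target -!sum_nat_const -big_split /=; apply: leq_sum => z.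
  rewrite inE => /andP[_ /eqP clz].
  have := @inj_hits (P 1%R) (fiber cl 1%R) (P 1%R) _ (subrI z) _ (sPF 1%R).
  rewrite cardF -/a1 => hits.
  suff : a1 <= \sum_(y in P 1%R) (z - y \in P 1%R)%R + (M - a1).
    by move: leP; set s := \sum_(_ in _) _; lia.
  apply: hits => y; rewrite !inE => /andP[_ /eqP cly].
  by rewrite -(inj_eq (addIr (cl y))) -clD subrK clz cly.
have two_two : a2 * a2 <= sum_count (P 2%R) (P 2%R) (P 1%R) + a2 * (M - a1).
  rewrite -!sum_nat_const -big_split /=; apply: leq_sum => x.
  rewrite inE => /andP[_ /eqP clx]; rewrite -(cardF 1%R).
  apply: (@inj_hits (P 2%R) (fiber cl 1%R) (P 1%R) _ (addrI x)) => // y.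
  by rewrite !inE clD clx => /andP[_ /eqP->].
rewrite (sum_countC (P 1%R) (P 0%R)) in split_ST.
apply: leq_trans split_ST.
move: zero_one one_one two_two.
set s01 := sum_count (P 0%R) _ _; set s11 := sum_count (P 1%R) (P 1%R) _.
set s22 := sum_count (P 2%R) _ _.
pose b := M - a1; have a1E : a1 = M - b by lia.
rewrite -/b => zero_one one_one two_two.
(* The excess of the count over M * t + t ^ 2 is at least
   b * (M - t - 2 * b) + a0 * (M - 2 * t - 3 * b). *)
have small_b : 2 * t + 3 * b <= M by lia.
have a2E : a2 + a0 = t + b by lia.
nia.
Qed.

(** All sums [1 + 1] of the fibers land in fiber 2 and all sums [2 + 2] in fiber
    1; the other two combinations of fibers 1 and 2 land in fiber 0. *)
Lemma ST_slice_union (cl : G -> 'Z_3) (c : G) (M : nat) (S : {set G}) :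
    {morph cl : x y / (x + y)%R} -> cl c = 1%R -> #|G| = 3 * M ->
    S \subset fiber cl 2%R ->
  ST (fiber cl 1%R :|: S) = M * #|S| + #|S| ^ 2.
Proof.
move=> clD clc cardG /subsetP S2.
have cardF k : #|fiber cl k| = M by have := card_fiber k clD clc; lia.
have clS x : x \in S -> cl x = 2%R by move/S2; rewrite inE => /eqP.
have memS x : (x \in S) = (x \in S) && (cl x == 2%R).
  by apply/idP/andP => [Sx | []] //; rewrite clS.
have -> : ST (fiber cl 1%R :|: S) = sum_count (fiber cl 1%R) (fiber cl 1%R) S
    + sum_count S S (fiber cl 1%R).
  rewrite ST_sum_count !sum_countE -big_split; apply: eq_bigr => x _ /=.
  rewrite -big_split; apply: eq_bigr => y _ /=; rewrite !inE.
  rewrite (memS x) (memS y) (memS (x + y)%R) clD.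
  case: (x \in S); case: (y \in S); case: (x + y \in S)%R;
  by case: (cl x) => [[|[|[|//]]] ?]; case: (cl y) => [[|[|[|//]]] ?].
rewrite sum_count_target; congr (_ + _).
  rewrite mulnC -(cardF 1%R) -sum_nat_const; apply: eq_bigr => z /clS clz.
  rewrite -sum1_card; apply: eq_bigr => y; rewrite !inE => /eqP cly.
  by rewrite -(inj_eq (addIr (cl y))) -clD subrK clz cly.
rewrite -mulnn -sum_nat_const; apply: eq_bigr => x /clS clx.
rewrite -sum1_card; apply: eq_bigr => y /clS cly.
by rewrite inE clD clx cly.
Qed.
End SumCounts.

(** * Schur triples in [(Z/3)^n] *)

Lemma rV_Z3_exponent (n : nat) (v : 'rV['Z_3]_n) : v *+ 3 = 0.
Proof.
apply/rowP => i; rewrite mulmxnE mxE.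
by case: (v 0 i) => [[|[|[|//]]] ?]; apply: val_inj.
Qed.

Lemma card_rV_Z3 (n : nat) : (0 < n)%N -> #|{: 'rV['Z_3]_n}| = (3 * 3 ^ n.-1)%N.
Proof. by move=> n_gt0; rewrite card_mx card_ord mul1n -expnS prednK. Qed.

Theorem theorem1p6 (R : realType) :
  exists delta : R, 0 < delta /\
    forall (n : nat) (hn : (0 < n)%N) (t : nat),
      t%:R <= delta * 3%:R ^+ n.-1 ->
      (forall A : {set 'rV['Z_3]_n},
         #|A| = (3 ^ n.-1 + t)%N -> (3 ^ n.-1 * t + t ^ 2 <= ST A)%N) /\
      (forall S : {set 'rV['Z_3]_n},
         S \subset slice (Ordinal hn) 2%:R -> #|S| = t -> sum_free S ->
         ST (slice (Ordinal hn) 1 :|: S) = (3 ^ n.-1 * t + t ^ 2)%N).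
Proof.
(* With 4000 * t <= M, fewer than M * t + t ^ 2 = t * (M + t) Schur triples are
   fewer than (M + t) ^ 2 / 3360, as near_slice requires. *)
exists (4000%:R^-1); split=> [|n hn t]; first by rewrite invr_gt0 ltr0n.
rewrite -natrX ler_pdivlMl ?ltr0n // -natrM ler_nat => small_t.
have cardG := card_rV_Z3 hn; set M := (3 ^ n.-1)%N in small_t cardG *.
split=> [A cardA | S S2 cardS _].
  have [// | fewST] := leqP (M * t + t ^ 2) (ST A).
  have cardGA : (#|{: 'rV['Z_3]_n}| <= 3 * #|A|)%N by rewrite cardG cardA; lia.
  have fewSTA : (3360 * ST A <= #|A| ^ 2)%N by rewrite cardA; nia.
  have [cl [clD [c clc] bigA]] := near_slice (@rV_Z3_exponent n) cardGA fewSTA.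
  have : (M * t + t ^ 2 <= ST A)%N.
    apply: (ST_near_slice clD clc cardG cardA); first lia.
    by apply: leq_trans bigA; rewrite cardA; lia.
  by rewrite leqNgt fewST.
pose cl (x : 'rV['Z_3]_n) := x 0 (Ordinal hn).
have clD : {morph cl : x y / x + y} by move=> x y; rewrite /cl mxE.
have clc : cl (const_mx 1) = 1 by rewrite /cl mxE.
by rewrite (ST_slice_union clD clc cardG S2) cardS.
Qed.
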